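(* Every diagram-like algebra over $R$ is, with the same datum $(\Lambda,G,M,C,* )$, a naive-cellular algebra over $R$.
   Context: $R$ is a commutative ring with unit. A naive-cellular algebra over $R$ is an associative unital $R$-algebra $A$ together with a naive-cellular datum $(\Lambda,G,M,C,* )$, where: (W1) $\Lambda$ is a poset; for each $\lambda\in\Lambda$, $G(\lambda)$ is a group and $M(\lambda)$ is a finite set (the link states of type $\lambda$), such that the map $\coprod_{\lambda\in\Lambda} M(\lambda)\times G(\lambda)\times M(\lambda)\to A$, $(p,\sigma,q)\mapsto C_{p,q}^{\sigma}$, is injective with image an $R$-basis of $A$. (W2) $*$ is an $R$-linear anti-involution of $A$ with $(C_{p,q}^{\sigma})^*=C_{q,p}^{\sigma^{-1}}$. (W3) If $\sigma\in G(\lambda)$ and $p,q\in M(\lambda)$, then for any $a\in A$ we have $aC_{p,q}^{\sigma}\equiv\sum_{\sigma'\in G(\lambda),\,p'\in M(\lambda)} r_a(p',\sigma'\sigma^{-1},p)\,C_{p',q}^{\sigma'} \pmod{I_{<\lambda}}$, where $r_a(p',\sigma'\sigma^{-1},p)\in R$ depends only on $a,p',p$ and the product $\sigma'\sigma^{-1}$, and $I_{<\lambda}$ is the $R$-span of the $C_{p'',q''}^{\tau}$ with $\mu<\lambda$, $\tau\in G(\mu)$, $p'',q''\in M(\mu)$. A diagram-like algebra over $R$ is defined identically (associative unital algebra $A$ with datum $(\Lambda,G,M,C,* )$ satisfying (W1) and (W2)), except that (W3) is replaced by the following condition. For any $\lambda_1,\lambda_2\in\Lambda$, $\sigma_i\in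 G(\lambda_i)$, $p_i,q_i\in M(\lambda_i)$ ($i=1,2$), we have $C_{p_1,q_1}^{\sigma_1}C_{p_2,q_2}^{\sigma_2}=\kappa\, C_{p,q}^{\sigma}$, where $\kappa\in R$ and $p,q,\sigma$ are given functions of the data on the left, such that, writing $\lambda\in\Lambda$ for the element with $p,q\in M(\lambda)$, $\sigma\in G(\lambda)$: (1) $\lambda\le\lambda_1$ and $\lambda\le\lambda_2$; (2) $\lambda$ and $\kappa$ depend only on $q_1$ and $p_2$; (3) $\sigma$ depends only on $\sigma_1,q_1,p_2,\sigma_2$; (4) $p$ depends only on $p_1,\sigma_1,q_1,p_2$; (5) if $\lambda=\lambda_2$, then $q=q_2$, and $\sigma\sigma_2^{-1}$ depends only on $\sigma_1,q_1,p_2$. *)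

(* Defs.v *)
From HB Require Import structures.
From mathcomp Require Import all_boot all_order all_algebra.
From mathcomp Require Import boolp classical_sets functions cardinality fsbigop.

Set Implicit Arguments.
Unset Strict Implicit.
Unset Printing Implicit Defensive.

Import Order.TTheory GRing.Theory.

Local Open Scope classical_set_scope.
Local Open Scope ring_scope.

(* [algType R] forces [1 != 0] in the algebra (and so in [R]).  This is the same
   notion with the zero algebra allowed.  It is a plain record because [algType]
   already sits above [PzRing] and [Lmodule] with no intermediate join, so
   Hierarchy-Builder refuses a new structure there. *)
Record pzAlgType (R : comPzRingType) := PzAlgType {
  pzalg_ring : pzRingType;
  pzalg_scale : R -> pzalg_ring -> pzalg_ring;
  pzalg_scalerA : forall j k a,
    pzalg_scale j (pzalg_scale k a) = pzalg_scale (j * k) a;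
  pzalg_scale1r : left_id 1 pzalg_scale;
  pzalg_scalerDr : right_distributive pzalg_scale +%R;
  pzalg_scalerDl : forall a, {morph pzalg_scale^~ a : j k / j + k};
  pzalg_scalerAl : forall k (a b : pzalg_ring),
    pzalg_scale k (a * b) = pzalg_scale k a * b;
  pzalg_scalerAr : forall k (a b : pzalg_ring),
    pzalg_scale k (a * b) = a * pzalg_scale k b
}.

Definition pzalg_sort (R : comPzRingType) (A : pzAlgType R) : Type :=
  pzalg_ring A.
Coercion pzalg_sort : pzAlgType >-> Sortclass.

HB.instance Definition _ (R : comPzRingType) (A : pzAlgType R) :=
  GRing.PzRing.on (pzalg_sort A).
HB.instance Definition _ (R : comPzRingType) (A : pzAlgType R) :=
  GRing.Zmodule_isLmodule.Build R (pzalg_sort A)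
    (@pzalg_scalerA R A) (@pzalg_scale1r R A)
    (@pzalg_scalerDr R A) (@pzalg_scalerDl R A).

Section LinearAlgebra.
Variables (R : pzRingType) (V : lmodType R).

Definition lspan (B : set V) : set V :=
  [set v | exists (s : seq V) (c : V -> R),
     (forall b, b \in s -> B b) /\ v = \sum_(b <- s) c b *: b].

Definition lindependent (B : set V) : Prop :=
  forall (s : seq V) (c : V -> R), uniq s -> (forall b, b \in s -> B b) ->
    \sum_(b <- s) c b *: b = 0 -> forall b, b \in s -> c b = 0.

Definition lbasis (B : set V) : Prop := lindependent B /\ lspan B = setT.

End LinearAlgebra.

Record cell_datum (R : comPzRingType) (A : pzAlgType R) := CellDatum {
  cell_disp : Order.disp_t;
  cell_poset : porderType cell_disp;
  cell_group : cell_poset -> groupType;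
  cell_states : cell_poset -> finType;
  cell_elt : forall l : cell_poset,
    cell_states l -> cell_group l -> cell_states l -> A;
  cell_star : A -> A
}.

Section CellAlgebras.
Variables (R : comPzRingType) (A : pzAlgType R) (D : cell_datum A).

Local Notation Lambda := (cell_poset D).
Local Notation G := (@cell_group R A D).
Local Notation M := (@cell_states R A D).
(* [C p s q] is $C_{p,q}^s$. *)
Local Notation C := (@cell_elt R A D _).
Local Notation star := (@cell_star R A D).

Definition cell_index : Type := {l : Lambda & (M l * G l * M l)%type}.

Definition cell_map (x : cell_index) : A :=
  C (tagged x).1.1 (tagged x).1.2 (tagged x).2.

Definition cell_basis : Prop := injective cell_map /\ lbasis (range cell_map).

Definition cell_anti_involution : Prop :=
  [/\ linear star,
      forall a b, star (a * b) = star b * star a,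
      involutive star &
      forall (l : Lambda) (p q : M l) (s : G l),
        star (C p s q) = C q (s^-1)%g p].

Definition cell_lower (l : Lambda) : set A :=
  lspan [set x | exists m : Lambda, (m < l)%O /\
                   exists (p q : M m) (t : G m), x = C p t q].

(* [G l] may be infinite: the finite-support clause is what makes the sum over
   [G l] meaningful, as [\sum_(i \in _)] is 0 on infinite support. *)
Definition naive_cellular_action : Prop :=
  exists r : A -> forall l : Lambda, M l -> G l -> M l -> R,
    (forall a (l : Lambda) (p' p : M l),
       finite_set [set g : G l | r a l p' g p != 0]) /\
    (forall (l : Lambda) (s : G l) (p q : M l) (a : A),
       cell_lower l
         (a * C p s q -
          \sum_(s' \in [set: G l]) \sum_(p' : M l)
             r a l p' (s' * s^-1)%g p *: C p' s' q)).

(* "Depends only on" is expressed by the arguments the structure functions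
   take; an element of [M l] carries its type [l]. *)
Definition diagram_like_product : Prop :=
  exists (lam : forall l1 l2 : Lambda, M l1 -> M l2 -> Lambda)
         (kappa : forall l1 l2 : Lambda, M l1 -> M l2 -> R)
         (sigma : forall (l1 l2 : Lambda)
            (s1 : G l1) (q1 : M l1) (p2 : M l2) (s2 : G l2),
            G (lam l1 l2 q1 p2))
         (pl : forall (l1 l2 : Lambda)
            (p1 : M l1) (s1 : G l1) (q1 : M l1) (p2 : M l2),
            M (lam l1 l2 q1 p2))
         (qr : forall (l1 l2 : Lambda)
            (p1 : M l1) (s1 : G l1) (q1 : M l1)
            (p2 : M l2) (s2 : G l2) (q2 : M l2),
            M (lam l1 l2 q1 p2)),
    [/\ forall (l1 l2 : Lambda) (p1 : M l1) (s1 : G l1) (q1 : M l1)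
               (p2 : M l2) (s2 : G l2) (q2 : M l2),
          C p1 s1 q1 * C p2 s2 q2 =
          kappa l1 l2 q1 p2 *:
            C (pl l1 l2 p1 s1 q1 p2)
              (sigma l1 l2 s1 q1 p2 s2)
              (qr l1 l2 p1 s1 q1 p2 s2 q2),
        forall (l1 l2 : Lambda) (q1 : M l1) (p2 : M l2),
          (lam l1 l2 q1 p2 <= l1)%O /\ (lam l1 l2 q1 p2 <= l2)%O,
        forall (l1 l2 : Lambda) (p1 : M l1) (s1 : G l1) (q1 : M l1)
               (p2 : M l2) (s2 : G l2) (q2 : M l2)
               (e : lam l1 l2 q1 p2 = l2),
          ecast l (M l) e (qr l1 l2 p1 s1 q1 p2 s2 q2) = q2 &
        forall (l1 l2 : Lambda) (s1 : G l1) (q1 : M l1) (p2 : M l2)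
               (s2 s2' : G l2) (e : lam l1 l2 q1 p2 = l2),
          (ecast l (G l) e (sigma l1 l2 s1 q1 p2 s2) * s2^-1 =
           ecast l (G l) e (sigma l1 l2 s1 q1 p2 s2') * s2'^-1)%g].

Definition naive_cellular : Prop :=
  [/\ cell_basis, cell_anti_involution & naive_cellular_action].

Definition diagram_like : Prop :=
  [/\ cell_basis, cell_anti_involution & diagram_like_product].

End CellAlgebras.

(* Main.v *)
(** For a basis element [a], condition (5) shows that [a * C p s q] is either
    strictly lower or a multiple of [C p' (g * s) q], where the coefficient,
    [p'] and [g] do not depend on [s] and [q]; so [r_a] can be taken to be a
    multiple of an indicator function.  The elements [a] admitting such
    coefficients form a submodule, hence are all of [A]. *)

Require Import Defs.
From mathcomp Require Import all_boot all_order all_algebra.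
From mathcomp Require Import boolp classical_sets functions cardinality fsbigop.

Set Implicit Arguments.
Unset Strict Implicit.
Unset Printing Implicit Defensive.

Import Order.TTheory GRing.Theory.

Local Open Scope classical_set_scope.
Local Open Scope ring_scope.

Lemma sum_mulrn_count (T : eqType) (V : nmodType) (F : T -> V) (s t : seq T) :
  uniq t -> {subset s <= t} ->
  \sum_(b <- t) F b *+ count_mem b s = \sum_(b <- s) F b.
Proof.
move=> ut; elim: s => [|x s IHs] st.
  by rewrite big_nil big1 // => b _; rewrite mulr0n.
rewrite big_cons -IHs; last by move=> y ys; apply: st; rewrite inE ys orbT.
have xt : x \in t by apply: st; rewrite mem_head.
under eq_bigr do rewrite /= mulrnDr.
rewrite big_split /=; congr (_ + _).
rewrite (bigD1_seq x) //= eqxx mulr1n big1 ?addr0 // => b.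
by rewrite eq_sym => /negbTE ->; rewrite mulr0n.
Qed.

Section Span.
Variables (R : pzRingType) (V : lmodType R) (B : set V).

Lemma lspan0 : lspan B 0.
Proof. by exists [::], (fun=> 0); split=> //; rewrite big_nil. Qed.

Lemma lspan_gen v : B v -> lspan B v.
Proof.
move=> Bv; exists [:: v], (fun=> 1); split; last by rewrite big_seq1 scale1r.
by move=> b; rewrite inE => /eqP ->.
Qed.

Lemma lspanZ k v : lspan B v -> lspan B (k *: v).
Proof.
move=> [s [c [sB ->]]]; exists s, (fun b => k * c b); split=> //.
by rewrite scaler_sumr; apply: eq_bigr => b _; rewrite scalerA.
Qed.

(* The coefficients of a combination are a function of the vector, so the two
   combinations are first rewritten over a common duplicate-free list. *)
Lemma lspanD u v : lspan B u -> lspan B v -> lspan B (u + v).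
Proof.
move=> [s [c [sB ->]]] [s' [c' [s'B ->]]].
exists (undup (s ++ s')),
  (fun b => c b *+ count_mem b s + c' b *+ count_mem b s'); split.
  by move=> b; rewrite mem_undup mem_cat => /orP [/sB | /s'B].
under [RHS]eq_bigr do rewrite scalerDl -!scalerMnl.
rewrite big_split /= !sum_mulrn_count ?undup_uniq // => b bs;
  by rewrite mem_undup mem_cat bs ?orbT.
Qed.

End Span.

Section Action.
Variables (R : comPzRingType) (A : pzAlgType R) (D : cell_datum A).

Local Notation Lambda := (cell_poset D).
Local Notation G := (@cell_group R A D).
Local Notation M := (@cell_states R A D).
Local Notation C := (@cell_elt R A D _).

(** The sum in (W3), where [f p' g] stands for $r_a(p',g,p)$ with $a$ and $p$ fixed. *)
Definition action_sum (l : Lambda) (f : M l -> G l -> R) (s : G l) (q : M l) :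
  A := \sum_(s' \in [set: G l]) \sum_(p' : M l)
         f p' (s' * s^-1)%g *: C p' s' q.

(** Condition (W3) for a single $a$, so that coefficients can be built element by element along
    linear combinations. *)
Definition action_coef (a : A) (r : forall l : Lambda, M l -> G l -> M l -> R) :=
  (forall (l : Lambda) (p' p : M l), finite_set [set g | r l p' g p != 0]) /\
  (forall (l : Lambda) (s : G l) (p q : M l),
     cell_lower l (a * C p s q - action_sum (fun p' g => r l p' g p) s q)).

(** The substitution $s' = gs$ removes $s$ from the coefficients. Any list [X] containing the
    support will do, so sums with different coefficients can be compared over one list. *)
Lemma action_sumE (l : Lambda) (X : seq (G l)) (f : M l -> G l -> R) s q :
  uniq X -> (forall p' g, g \notin X -> f p' g = 0) ->
  action_sum f s q = \sum_(g <- X) \sum_(p' : M l) f p' g *: C p' (g * s)%g q.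
Proof.
move=> uX fX; rewrite /action_sum.
rewrite (@fsbigE _ _ _ _ _ (map (fun g => g * s)%g X)) //=; first last.
- move=> s' _ s'X; apply: big1 => p' _; rewrite fX ?scale0r //.
  apply: contra s'X => sX; apply/mapP; exists (s' * s^-1)%g => //.
  by rewrite -mulgA mulVg mulg1.
- by rewrite map_inj_uniq //; apply: mulIg.
rewrite big_map; apply: eq_big => [g|g _]; first by rewrite in_setT.
by under eq_bigr do rewrite -mulgA mulgV mulg1.
Qed.

(** As [M l] is finite, the union of the supports over all [p'] is still finite, and one list serves
    every [p']. *)
Lemma finite_support_seq (l : Lambda) (f : M l -> G l -> R) :
  (forall p', finite_set [set g | f p' g != 0]) ->
  exists2 X : seq (G l), uniq X & forall p' g, g \notin X -> f p' g = 0.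
Proof.
move=> fin.
have /finite_seqP [X EX] :
    finite_set (\bigcup_(p' in [set: M l]) [set g | f p' g != 0]).
  by apply: bigcup_finite => //; apply: finite_finset.
exists (undup X) => [|p' g]; first exact: undup_uniq.
rewrite mem_undup; apply: contraNeq => fg.
have : [set` X] g by rewrite -EX; exists p'.
by [].
Qed.

Lemma action_coef0 : action_coef 0 (fun _ _ _ _ => 0).
Proof.
split=> [l p' p|l s p q].
  by rewrite (_ : [set _ | _] = set0) // -subset0 => g /=; rewrite eqxx.
rewrite (@action_sumE _ [::]) // big_nil mul0r subr0; exact: lspan0.
Qed.

Lemma action_coefZ k a r :
  action_coef a r -> action_coef (k *: a) (fun l p' g p => k * r l p' g p).
Proof.
move=> [fin low]; split=> [l p' p|l s p q].
  apply: sub_finite_set (fin l p' p) => g /=; apply: contraNneq => ->.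
  by rewrite mulr0.
have [X uX rX] := finite_support_seq (fin l ^~ p).
have := lspanZ k (low l s p q).
rewrite !(@action_sumE _ X) // => [|p' g /rX ->]; last by rewrite mulr0.
rewrite /cell_lower scalerBr scaler_sumr.
have -> : k *: (a * C p s q) = k *: a * C p s q by apply: pzalg_scalerAl.
congr (lspan _ (_ - _)); apply: eq_bigr => g _; rewrite scaler_sumr.
by apply: eq_bigr => p' _; rewrite scalerA.
Qed.

Lemma action_coefD a b r t :
  action_coef a r -> action_coef b t ->
  action_coef (a + b) (fun l p' g p => r l p' g p + t l p' g p).
Proof.
move=> [finr lowr] [fint lowt]; split=> [l p' p|l s p q].
  have : finite_set ([set g | r l p' g p != 0] `|` [set g | t l p' g p != 0]).
    by rewrite finite_setU.
  apply: sub_finite_set => g /=.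
  case: (eqVneq (r l p' g p) 0) => [->|]; last by left.
  by rewrite add0r; right.
have [X uX rX] := finite_support_seq (finr l ^~ p).
have [Y uY tY] := finite_support_seq (fint l ^~ p).
(* A list covering both supports, over which the two sums add termwise. *)
pose Z := undup (X ++ Y).
have uZ : uniq Z by apply: undup_uniq.
have rZ p' g : g \notin Z -> r l p' g p = 0.
  by rewrite mem_undup mem_cat negb_or => /andP [/rX ->].
have tZ p' g : g \notin Z -> t l p' g p = 0.
  by rewrite mem_undup mem_cat negb_or => /andP [_ /tY ->].
have := lspanD (lowr l s p q) (lowt l s p q).
rewrite !(@action_sumE _ Z) // => [|p' g gZ]; last by rewrite rZ ?tZ ?addr0.
rewrite /cell_lower addrACA -opprD -mulrDl -big_split /=.
congr (lspan _ (_ - _)); apply: eq_bigr => g _; rewrite -big_split /=.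
by apply: eq_bigr => p' _; rewrite scalerDl.
Qed.

Lemma cell_elt_ecast (l l' : Lambda) (e : l = l') (p q : M l) (s : G l) :
  C (ecast x (M x) e p) (ecast x (G x) e s) (ecast x (M x) e q) = C p s q.
Proof. by case: l' / e. Qed.

Lemma action_coef_cell_map (x : cell_index D) :
  diagram_like_product D -> exists r, action_coef (cell_map x) r.
Proof.
move=> [lam [kappa [sigma [pl [qr [mulC lam_le qrE sigmaE]]]]]].
case: x => l1 [[p1 s1] q1]; rewrite /cell_map /=.
(* Condition (5) makes $\sigma s^{-1}$ independent of $s$ when the product stays in the cell of [l];
   [g0] is its value at $s = 1$. The equality [e] transports states and group elements to type
   [l]. *)
pose p0 l (p : M l) (e : lam l1 l q1 p = l) :=
  ecast x (M x) e (pl l1 l p1 s1 q1 p).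
pose g0 l (p : M l) (e : lam l1 l q1 p = l) :=
  ecast x (G x) e (sigma l1 l s1 q1 p 1%g).
pose r l (p' : M l) (g : G l) (p : M l) : R :=
  if pselect (lam l1 l q1 p = l) is left e then
    if (p' == p0 l p e) && (g == g0 l p e) then kappa l1 l q1 p else 0
  else 0.
exists r; split=> [l p' p|l s p q].
  rewrite /r; case: pselect => [e|_]; last first.
    by rewrite (_ : [set _ | _] = set0) // -subset0 => g /=; rewrite eqxx.
  apply: sub_finite_set (finite_set1 (g0 l p e)) => g /=.
  by case: ifP => [/andP [_ /eqP ->]|]; rewrite ?eqxx.
have [le1 le2] := lam_le l1 l q1 p.
(* If the type of the product differs from [l], it is strictly below [l] by condition (1): the
   product is already a lower term, and zero coefficients suffice. *)
rewrite mulC /r; case: pselect => [e|ne]; last first.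
  rewrite (@action_sumE _ [::]) // big_nil subr0.
  apply: lspanZ; apply: lspan_gen; exists (lam l1 l q1 p); split.
    by rewrite lt_neqAle le2 andbT; apply/eqP.
  by do 3 eexists.
rewrite (@action_sumE _ [:: g0 l p e]) //; last first.
  by move=> p' g; rewrite inE => /negbTE ->; rewrite andbF.
(* Only the term at [p0] and [g0] survives; it equals the product exactly, with no lower
   correction. *)
rewrite big_seq1 (bigD1 (p0 l p e)) //= !eqxx /= big1 ?addr0; last first.
  by move=> p' /negbTE ->; rewrite scale0r.
rewrite -(cell_elt_ecast e) qrE.
(* Condition (5) compared at $s$ and at $1$. *)
have -> : (g0 l p e * s)%g = ecast x (G x) e (sigma l1 l s1 q1 p s).
  have /= := sigmaE l1 l s1 q1 p s 1%g e.
  by rewrite invg1 mulg1 -/(g0 l p e) => <-; rewrite -mulgA mulVg mulg1.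
rewrite subrr; exact: lspan0.
Qed.

End Action.

Theorem proposition2p6 (R : comPzRingType) (A : pzAlgType R)
    (D : cell_datum A) :
  diagram_like D -> naive_cellular D.
Proof.
move=> [basis star prod]; split=> //.
have coef a : exists r, action_coef (D := D) a r.
  have : lspan (range (@cell_map R A D)) a by case: basis => _ [_ ->].
  move=> [s [c [sB ->]]]; elim: s sB => [|b s IHs] sB.
    by rewrite big_nil; eexists; apply: action_coef0.
  rewrite big_cons.
  have [t ht] : exists t, action_coef (D := D) (\sum_(j <- s) c j *: j) t.
    by apply: IHs => y ys; apply: sB; rewrite inE ys orbT.
  have [x _ <-] := sB b (mem_head _ _).
  have [r hr] := action_coef_cell_map x prod.
  by eexists; apply: action_coefD ht; apply: action_coefZ hr.
(* (W3) asks for one function of $a$, so coefficients are chosen for all $a$ at once. *)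
have [r hr] := choice coef.
exists r; split=> [a l p' p|l s p q a]; first by have [fin _] := hr a.
by have [_ low] := hr a; apply: low.
Qed.
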